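(* For all integers $n\geq 1$ and $k\geq 0$, \[\bigl|s^{-1}(\operatorname{Av}_{n,k}(231,312,321))\bigr|=\frac{1}{n+1}\binom{n-k-1}{k}\binom{2n-2k}{n},\] where $\operatorname{Av}_{n,k}(231,312,321)$ is the set of permutations in $\operatorname{Av}_n(231,312,321)$ having exactly $k$ descents.
   Context: $S_n$ is the set of permutations of $\{1,\dots,n\}$ in one-line notation. The normalization of a sequence of $m$ distinct positive integers is the element of $S_m$ obtained by replacing the $i$-th smallest entry by $i$. A permutation $\sigma=\sigma_1\cdots\sigma_n$ contains a pattern $\tau\in S_m$ if there are indices $i_1<\cdots<i_m$ such that the normalization of $\sigma_{i_1}\cdots\sigma_{i_m}$ is $\tau$; otherwise it avoids $\tau$. $\operatorname{Av}_n(\tau^{(1)},\ldots)$ is the set of permutations in $S_n$ avoiding all listed patterns. A descent of $\pi=\pi_1\cdots\pi_n$ is an index $i\in[n-1]$ with $\pi_i>\pi_{i+1}$. The stack-sorting map $s$ is defined recursively on permutations of finite sets of positive integers: $s$ sends the empty permutation to itself, and if $\pi$ is nonempty with largest entry $m$, write $\pi=LmR$ and set $s(\pi)=s(L)\,s(R)\,m$. For a set $A$ of permutations, $s^{-1}(A)$ is the set of all permutations $\sigma$ with $s(\sigma)\in A$. Binomial coefficients $\binom{a}{b}$ with $b>a\ge 0$ or with $a<0$ are taken to be $0$ (the standard convention, so the right side vanishes when $n-k-1<k$). *)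

(* Defs.v *)
From mathcomp Require Import all_boot.
From mathcomp Require Import boolp classical_sets.

Set Implicit Arguments.
Unset Strict Implicit.
Unset Printing Implicit Defensive.

Local Open Scope classical_set_scope.

(* A permutation of a finite set of positive integers is the word listing its
   entries from left to right; [S_ n] consists of those whose entries are
   exactly 1, ..., n. *)
Definition is_perm_word (w : seq nat) : bool := uniq w && (0 \notin w).

Definition S_ (n : nat) : set (seq nat) := [set w | perm_eq w (iota 1 n)].

(* [index x (sort leq w)] is 0-based, hence the successor. *)
Definition normalize (w : seq nat) : seq nat :=
  [seq (index x (sort leq w)).+1 | x <- w].

Definition contains (sigma tau : seq nat) : Prop :=
  exists2 u : seq nat, subseq u sigma & normalize u = tau.

Definition avoids (sigma tau : seq nat) : Prop := ~ contains sigma tau.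

Definition Av (n : nat) (taus : seq (seq nat)) : set (seq nat) :=
  [set sigma | S_ n sigma /\ forall tau, tau \in taus -> avoids sigma tau].

(* Positions are 0-based here: i stands for the index i.+1 in [n-1]. *)
Definition descents (w : seq nat) : seq nat :=
  [seq i <- iota 0 (size w).-1 | nth 0 w i > nth 0 w i.+1].

Definition Avk (n k : nat) (taus : seq (seq nat)) : set (seq nat) :=
  [set sigma | Av n taus sigma /\ size (descents sigma) = k].

(* The first argument bounds the recursion depth; the recursion equations,
   free of it, are [stack_sort0] and [stack_sortE]. *)
Fixpoint stack_sort_rec (fuel : nat) (w : seq nat) : seq nat :=
  if fuel is fuel'.+1 then
    if w is [::] then [::] else
    let m := \max_(x <- w) x in
    let i := index m w in
    stack_sort_rec fuel' (take i w) ++ stack_sort_rec fuel' (drop i.+1 w)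
      ++ [:: m]
  else [::].

Definition stack_sort (w : seq nat) : seq nat := stack_sort_rec (size w) w.

Definition stack_preimage (A : set (seq nat)) : set (seq nat) :=
  [set sigma | is_perm_word sigma /\ A (stack_sort sigma)].

Lemma stack_sort0 : stack_sort [::] = [::].
Proof. by []. Qed.

Lemma max_seq_in (w : seq nat) : w != [::] -> \max_(x <- w) x \in w.
Proof.
elim: w => // x w IHw _; rewrite big_cons in_cons.
have [->|w_n0] := eqVneq w [::]; first by rewrite big_nil maxn0 eqxx.
by rewrite /maxn; case: ifP => _; rewrite ?eqxx // IHw ?orbT.
Qed.

Lemma stack_sort_rec_fuel (f w : _) :
  size w <= f -> stack_sort_rec f w = stack_sort w.
Proof.
rewrite /stack_sort; move: {2}f (leqnn f) => N.
elim: N f w => [|N IHN] [|f] [|x w] //= le_fN le_wf.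
set v := x :: w; set m := \max_(y <- v) y.
have lt_mv : index m v < size v by rewrite index_mem max_seq_in.
have le_wN : size w <= N by exact: leq_trans le_wf le_fN.
have le_t : size (take (index m v) v) <= size w.
  by rewrite size_take lt_mv -ltnS.
have le_d : size (drop (index m v) w) <= size w by rewrite size_drop leq_subr.
rewrite (IHN f) ?(IHN f (drop _ _)) ?(leq_trans le_t) ?(leq_trans le_d) //.
by rewrite (IHN (size w)) // (IHN (size w) (drop _ _)).
Qed.

Lemma stack_sortE (L R : seq nat) (m : nat) :
    uniq (L ++ m :: R) -> (forall x, x \in L ++ R -> x <= m) ->
  stack_sort (L ++ m :: R) = stack_sort L ++ stack_sort R ++ [:: m].
Proof.
move=> uLR maxm.
have Em : \max_(x <- L ++ m :: R) x = m.
  apply/eqP; rewrite eqn_leq; apply/andP; split; last first.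
    by apply: (@leq_bigmax_seq _ _ predT id) => //; rewrite mem_cat mem_head orbT.
  apply/bigmax_leqP_seq => x; rewrite mem_cat in_cons => xLR _.
  have [->//|x_m] := eqVneq x m; apply: maxm.
  by rewrite mem_cat; move: xLR; rewrite (negPf x_m).
have mL : m \notin L.
  by move: uLR; rewrite cat_uniq /= => /and3P[_ /norP[]].
have Ei : index m (L ++ m :: R) = size L.
  by rewrite index_cat (negPf mL) /= eqxx addn0.
rewrite {1}/stack_sort size_cat /= addnS /=.
case Ew: (L ++ m :: R) => [|x w]; first by case: (L) Ew.
rewrite -Ew Em Ei take_size_cat // drop_cat ltnNge leqnSn /= subSnn /= drop0.
by rewrite !stack_sort_rec_fuel ?leq_addr ?leq_addl.
Qed.

(* Main.v *)
Require Import Defs.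
From mathcomp Require Import all_boot all_order all_algebra finmap.
From mathcomp Require Import boolp classical_sets cardinality.
From mathcomp Require Import zify ring.

(* A word avoids 231, 312 and 321 exactly when it is a direct sum of blocks 1
   and 21, and its descents are the blocks 21.  If sigma = L m R with m the
   largest letter, then s(L) s(R) m is such a sum iff s(L) and s(R) are and
   either the cut between L and R falls between two blocks, or it falls inside
   a block 21; in the second case L is nonempty and s(R) begins with its least
   letter (s(L) ends with its largest letter anyway).  Let 1 + H be the
   generating function of the preimages, x marking length and y descents, and
   G that of the nonempty ones whose image begins with its least letter.  Then
     H = x ((1 + H)^2 + y H G),
     G = x (1 + G + G (1 + H) + y (G - x) G).
   Eliminating G gives H = x (1 + H)^2 (1 + x y H), and the coefficients of all
   powers of H are found together as in Lagrange inversion. *)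

Import GRing.Theory Num.Theory.
Local Open Scope ring_scope.
Set Implicit Arguments.
Unset Strict Implicit.

(** * Cutting a permutation at its largest letter *)

Section Words.
Local Open Scope nat_scope.

(** The induction that fits [layered], which strips either one letter or two. *)
Lemma seq_ind2step (T : Type) (P : seq T -> Prop) :
    P [::] -> (forall x, P [:: x]) ->
    (forall x y w, P w -> P (y :: w) -> P [:: x, y & w]) ->
  forall w, P w.
Proof.
move=> P0 P1 P2 w; suff [] : P w /\ forall x, P (x :: w) by [].
by elim: w => [|y w [Pw Pyw]]; split=> // x; apply: P2.
Qed.

Lemma mem_lt_max (A : seq nat) m x : sorted ltn (rcons A m) -> x \in A -> x < m.
Proof.
by rewrite (sorted_pairwise ltn_trans) pairwise_rcons => /andP[/allP Am _] /Am.
Qed.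

Lemma sorted_ltn_rcons (A : seq nat) m : sorted ltn (rcons A m) -> sorted ltn A.
Proof. by rewrite -cats1 => /cat_sorted2[]. Qed.

Lemma sorted_ltn_notin (A : seq nat) m : sorted ltn (rcons A m) -> m \notin A.
Proof. by move=> sA; apply/negP => /(mem_lt_max sA); rewrite ltnn. Qed.

Lemma perm_cut_max (A L R : seq nat) m :
  perm_eq (L ++ m :: R) (rcons A m) = perm_eq (L ++ R) A.
Proof.
by rewrite perm_catC perm_sym perm_rcons /= perm_cons perm_sym perm_catC.
Qed.

Lemma stack_sort_cut (A L R : seq nat) m :
    sorted ltn (rcons A m) -> perm_eq (L ++ R) A ->
  stack_sort (L ++ m :: R) = (stack_sort L ++ stack_sort R) ++ [:: m].
Proof.
move=> sA pLR; rewrite -catA; apply: stack_sortE => [|x]; last first.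
  by rewrite (perm_mem pLR) => /(mem_lt_max sA)/ltnW.
rewrite (perm_uniq (_ : perm_eq _ (rcons A m))) ?perm_cut_max //.
exact: sorted_uniq ltn_trans ltnn _ sA.
Qed.

Lemma max_cutP (A w : seq nat) (m : nat) : perm_eq w (rcons A m) ->
  exists L R, w = L ++ m :: R /\ perm_eq (L ++ R) A.
Proof.
move=> pw; have : m \in w by rewrite (perm_mem pw) mem_rcons mem_head.
by move: pw => /[swap] /splitPr[L R]; rewrite perm_cut_max; exists L, R.
Qed.

Lemma perm_stack_sort (w : seq nat) : uniq w -> perm_eq (stack_sort w) w.
Proof.
move: {2}(size w) (leqnn (size w)) => n; elim: n w => [|n IHn] w.
  by rewrite leqn0 size_eq0 => /eqP->.
move=> wn uw; have /permPl := perm_sort leq w; have := sort_sorted leq_total w.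
rewrite -(sort_uniq leq) in uw.
case/lastP: (sort leq w) uw => [|A m] uA sA pw.
  by move: pw; rewrite perm_sym => /perm_nilP->.
have {uA} {}sA : sorted ltn (rcons A m) by rewrite ltn_sorted_uniq_leq uA.
have [L [R [Ew p]]] : exists L R, w = L ++ m :: R /\ perm_eq (L ++ R) A.
  by apply: max_cutP; rewrite perm_sym.
rewrite Ew (stack_sort_cut sA p) perm_catC perm_sym -(cat1s m R) perm_catCA /=.
rewrite perm_cons perm_sym.
have : uniq (L ++ R).
  by rewrite (perm_uniq p) (sorted_uniq ltn_trans ltnn) // (sorted_ltn_rcons sA).
rewrite cat_uniq => /and3P[uL _ uR].
move: wn; rewrite Ew size_cat /= => wn.
by apply: perm_cat; apply: IHn => //; lia.
Qed.

(** * Direct sums of blocks 1 and 21, and their descents *)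

Fixpoint layered (w : seq nat) : bool :=
  if w is a :: w1 then
    (all (ltn a) w1 && layered w1)
    || (if w1 is b :: w2 then [&& b < a, all (ltn a) w2 & layered w2] else false)
  else true.

Fixpoint des (w : seq nat) : nat :=
  if w is a :: w1 then (if w1 is b :: _ then (b < a : nat) else 0) + des w1 else 0.

Lemma size_descents w : size (descents w) = des w.
Proof.
rewrite /descents size_filter; case: w => //= a w.
elim: w a => //= b w IHw a; rewrite -IHw; congr (_ + _).
by rewrite -[1]addn0 iotaDl count_map.
Qed.

Lemma des_cat u b a v :
  des (rcons u b ++ a :: v) = des (rcons u b) + (a < b) + des (a :: v).
Proof.
elim: u => [|x u IHu] /=; first by rewrite !addn0.
by rewrite IHu !addnA; case: u {IHu}.
Qed.

Lemma des_cat_lt u v : allrel ltn u v -> des (u ++ v) = des u + des v.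
Proof.
case: v => [|a v]; first by rewrite cats0 addn0.
case/lastP: u => // u b; rewrite des_cat => /allrelP/(_ b a).
by rewrite mem_rcons !mem_head => /(_ isT isT) /= ba; rewrite ltnNge ltnW // addn0.
Qed.

Lemma layered_lt_cons a w : all (ltn a) w -> layered (a :: w) = layered w.
Proof.
move=> aw /=; rewrite aw /=; case: w aw => //= b w /andP[ab _].
by rewrite [b < a]ltnNge ltnW // orbF.
Qed.

(** The first disjunct strips a leading block 1, the second a leading block 21; in the latter [w] is
    compared with [x] only, the larger letter of the block. *)
Lemma layered_cons2 x y w : layered [:: x, y & w] =
  (all (ltn x) (y :: w) && layered (y :: w)) || [&& y < x, all (ltn x) w & layered w].
Proof. by []. Qed.

Lemma layered_cat u v : allrel ltn u v -> layered (u ++ v) = layered u && layered v.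
Proof.
elim/seq_ind2step: u => [//|x|x y w IHw IHyw].
  by rewrite allrel1l => /layered_lt_cons.
rewrite !allrel_consl => /and3P[xv yv wv].
rewrite !cat_cons !layered_cons2 -cat_cons IHyw ?allrel_consl ?yv // IHw //.
by rewrite !all_cat xv !andbT !andbA -andb_orl.
Qed.

(** Blocks are stripped from the left until one reaches the cut. A block 21 cannot end in [b], the
    largest letter on its side. So either [b] is a block by itself and the two sides are ordered, or
    [b a] is a block 21. *)
Lemma layered_cat_max u b a v : all (ltn^~ b) u ->
    layered (rcons u b ++ a :: v) ->
  allrel ltn (rcons u b) (a :: v)
  \/ [/\ a < b, all (ltn^~ a) u & all (ltn b) v].
Proof.
elim/seq_ind2step: u => [|x|x y w IHw IHyw].
- move=> _; rewrite [rcons _ _ ++ _]/= layered_cons2 => /orP[/andP[bav _]|/and3P[ab bv _]].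
    by left; rewrite allrel1l.
  by right.
- rewrite [all _ _]/= andbT => xb; rewrite !cat_cons layered_cons2.
  case/orP=> [/andP[/and3P[_ xa xv]]|/and3P[bx _ _]]; last by rewrite ltnNge ltnW in bx.
  rewrite layered_cons2 => /orP[/andP[bav _]|/and3P[ab bv _]].
    by left; rewrite !allrel_consl bav allrel0l !andbT; apply/andP.
  by right; rewrite /= ?andbT.
move=> /and3P[xb yb wb]; rewrite !rcons_cons !cat_cons layered_cons2.
case/orP=> [/andP[+ lyw]|/and3P[yx + lw]].
  rewrite /= all_cat => /and4P[xy _ xa xv].
  have [|yav|[ab ya bv]] := IHyw _ lyw; first exact/andP.
    by left; rewrite allrel_consl yav andbT; apply/andP.
  by right; split=> //; apply/andP.
rewrite all_cat => /and3P[_ xa xv].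
have yav : all (ltn y) (a :: v).
  by apply/andP; split; [apply: ltn_trans xa | apply: sub_all xv => z; apply: ltn_trans].
have [//|wav|[ab wa bv]] := IHw _ lw.
  by left; rewrite !allrel_consl yav wav !andbT; apply/andP.
by right; split=> //; apply/and3P; split=> //; apply: ltn_trans xa.
Qed.

Lemma layered_swap u b a v :
    a < b -> all (ltn^~ a) u -> all (ltn b) v -> layered u -> layered v ->
  layered (rcons u b ++ a :: v).
Proof.
move=> ab ua bv lu lv; rewrite cat_rcons layered_cat; last first.
  apply/allrelP => x y /(allP ua) xa; rewrite !inE => /or3P[/eqP->|/eqP->|/(allP bv)].
  - exact: ltn_trans ab.
  - by [].
  - by apply: ltn_trans; apply: ltn_trans ab.
by rewrite lu layered_cons2 ab bv lv !orbT.
Qed.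

Lemma layered_rcons u b : all (ltn^~ b) u -> layered (rcons u b) = layered u.
Proof.
by move=> ub; rewrite -cats1 layered_cat ?allrel1r //= andbT.
Qed.

(** * Pattern avoidance *)

Definition bad_triple a b c := (c < a) && ((b < a) || (c < b)).

Lemma subseq_consP (T : eqType) (a x : T) s w : subseq (a :: s) (x :: w) ->
  (a = x /\ subseq s w) \/ subseq (a :: s) w.
Proof. by move=> /=; case: eqP => [-> |_]; [left | right]. Qed.

(** For distinct letters, [bad_triple] singles out the patterns 231, 312 and 321. If none occurs,
    comparing the first two letters with each later one exhibits a leading block. Conversely, a
    triple that starts in the first block has its last letter beyond that block, hence larger than
    its first letter. *)
Lemma layeredP (w : seq nat) : uniq w ->
  reflect (forall a b c, subseq [:: a; b; c] w -> ~~ bad_triple a b c) (layered w).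
Proof.
move=> uw; apply: (iffP idP) => [|ok]; last first.
  elim/seq_ind2step: w uw ok => // x y w IHw IHyw uw ok.
  have [ww lyw] : layered w /\ layered (y :: w).
    have sub1 : subseq (y :: w) [:: x, y & w] := subseq_cons _ _.
    have sub2 : subseq w [:: x, y & w] := subseq_trans (subseq_cons _ _) sub1.
    split; [apply: IHw | apply: IHyw].
    - exact: subseq_uniq sub2 uw.
    - by move=> a b c /subseq_trans/(_ sub2)/ok.
    - exact: subseq_uniq sub1 uw.
    - by move=> a b c /subseq_trans/(_ sub1)/ok.
  rewrite layered_cons2 lyw ww !andbT.
  move: uw => /= /and3P[]; rewrite inE negb_or => /andP[xy xw] yw _.
  have xyz z : z \in w -> ~~ bad_triple x y z.
    by move=> zw; apply: ok; rewrite /= !eqxx sub1seq.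
  case: ltngtP xy => //= [xy|yx] _; rewrite ?orbF; apply/allP=> z zw;
    have := xyz z zw; have : x != z by apply: contraNneq xw => ->.
    by rewrite /bad_triple /=; lia.
  by rewrite /bad_triple /=; lia.
elim/seq_ind2step: w uw => [_ _ a b c|x _ _ a b c|x y w IHw IHyw uw].
- by [].
- by rewrite /=; case: ifP.
have /andP[_ uyw] := uw; have /andP[_ uw'] := uyw.
rewrite layered_cons2 => /orP[/andP[xyw lyw]|/and3P[yx xw lw]] a b c.
  case/subseq_consP=> [[-> s]|]; last exact: IHyw.
  have /(allP xyw) /= : c \in y :: w.
    by apply: (mem_subseq s); rewrite !inE eqxx orbT.
  by rewrite /bad_triple /=; lia.
have lt_w z : z \in w -> y < z by move=> /(allP xw); apply: ltn_trans.
case/subseq_consP=> [[->]|]; case/subseq_consP=> [[->]|s].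
- by rewrite sub1seq => /(allP xw) /=; rewrite /bad_triple; lia.
- have /(allP xw) /= : b \in w by apply: (mem_subseq s); rewrite inE eqxx.
  have /(allP xw) /= : c \in w by apply: (mem_subseq s); rewrite !inE eqxx orbT.
  by rewrite /bad_triple /=; lia.
- move=> s; have /lt_w : b \in w by apply: (mem_subseq s); rewrite inE eqxx.
  have /lt_w : c \in w by apply: (mem_subseq s); rewrite !inE eqxx orbT.
  by rewrite /bad_triple /=; lia.
- exact: IHw.
Qed.

Lemma avoid_layered (w : seq nat) : uniq w ->
  (forall tau, tau \in [:: [:: 2; 3; 1]; [:: 3; 1; 2]; [:: 3; 2; 1]] -> avoids w tau)
  <-> layered w.
Proof.
move=> uw; apply: iff_trans (rwP (layeredP uw)).
(* The ranks depend only on the set of letters, so one computation serves all three patterns. *)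
have normal3 a b c u : a < b -> b < c -> perm_eq u [:: a; b; c] ->
    [/\ index a (sort leq u) = 0, index b (sort leq u) = 1 & index c (sort leq u) = 2].
  move=> ab bc p; have ac := ltn_trans ab bc.
  have -> : sort leq u = [:: a; b; c].
    apply: (sorted_eq leq_trans anti_leq); first exact: sort_sorted leq_total u.
      by rewrite /= (ltnW ab) (ltnW bc).
    by rewrite perm_sort.
  by rewrite /= !eqxx !ltn_eqF.
split=> [av a b c sub|ok tau].
  apply/negP; rewrite /bad_triple => /andP[ca bad].
  have : uniq [:: a; b; c] by apply: subseq_uniq uw.
  rewrite /= !inE negb_or andbT => /andP[/andP[ab ac] bc].
  case: (ltngtP b c) bc bad => // [bc|cb] _ bad.
    rewrite orbF in bad.
    apply: (av [:: 3; 1; 2]) => //; exists [:: a; b; c] => //.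
    have [|||i1 i2 i3] := normal3 b c a [:: a; b; c] => //; first by apply/permP=> q /=; lia.
    by rewrite /normalize /= i1 i2 i3.
  case: (ltngtP a b) ab bad => // [ab|ba] _ bad.
    apply: (av [:: 2; 3; 1]) => //; exists [:: a; b; c] => //.
    have [|||i1 i2 i3] := normal3 c a b [:: a; b; c] => //; first by apply/permP=> q /=; lia.
    by rewrite /normalize /= i1 i2 i3.
  apply: (av [:: 3; 2; 1]) => //; exists [:: a; b; c] => //.
    have [|||i1 i2 i3] := normal3 c b a [:: a; b; c] => //; first by apply/permP=> q /=; lia.
    by rewrite /normalize /= i1 i2 i3.
move=> tauin [u sub nu].
have su : size u = 3.
  by move: tauin; rewrite -(size_map (fun x => (index x (sort leq u)).+1)) [map _ _]nu !inE;
    case/or3P=> /eqP->.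
case: u su nu sub => [//|a [//|b [//|c [|//]]]] _ nu sub.
have := ok _ _ _ sub; rewrite /normalize /= in nu.
(* Conversely, positions in the sorted triple recover the order of the letters. *)
have lt_idx x y : x \in [:: a; b; c] -> y \in [:: a; b; c] ->
    index x (sort leq [:: a; b; c]) < index y (sort leq [:: a; b; c]) -> x < y.
  move=> xu yu lt; have := sorted_ltn_index leq_trans (sort_sorted leq_total [:: a; b; c]).
  move/(_ x y); rewrite !mem_sort => /(_ xu yu lt) le; rewrite ltn_neqAle le.
  by rewrite andbT; apply: contraTneq lt => ->; rewrite ltnn.
have [ia ib ic] : [/\ a \in [:: a; b; c], b \in [:: a; b; c] & c \in [:: a; b; c]].
  by rewrite !inE !eqxx !orbT.
have := lt_idx c a ic ia; have := lt_idx b a ib ia; have := lt_idx c b ic ib.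
move: tauin; rewrite -nu !inE /bad_triple.
by case/or3P=> /eqP[-> -> ->] /=; lia.
Qed.

(** * Distribution of the alphabet over the two sides of the largest letter *)

Lemma sorted_ltn_uniq (A : seq nat) : sorted ltn A -> uniq A.
Proof. exact: sorted_uniq ltn_trans ltnn A. Qed.

Lemma perm_cat_uniq (A L R : seq nat) : sorted ltn A -> perm_eq (L ++ R) A -> uniq L /\ uniq R.
Proof.
move=> sA p; have := sorted_ltn_uniq sA.
by rewrite -(perm_uniq p) cat_uniq => /and3P[].
Qed.

Lemma stack_sort_cut_lt (A L R : seq nat) m : sorted ltn (rcons A m) -> perm_eq (L ++ R) A ->
  all (ltn^~ m) (stack_sort L ++ stack_sort R).
Proof.
move=> sA p; have [uL uR] := perm_cat_uniq (sorted_ltn_rcons sA) p.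
rewrite (perm_all _ (perm_cat (perm_stack_sort uL) (perm_stack_sort uR))) (perm_all _ p).
by apply/allP=> x; apply: mem_lt_max.
Qed.

(** Sorting [u] and [v] separately and concatenating gives an increasing list with the letters of
    [A], hence [A] itself. *)
Lemma perm_cut (A u v : seq nat) : sorted ltn A -> perm_eq (u ++ v) A ->
  allrel ltn u v -> perm_eq u (take (size u) A) /\ perm_eq v (drop (size u) A).
Proof.
move=> sA p uv; suff EA : A = sort leq u ++ sort leq v.
  split; [rewrite EA take_size_cat | rewrite EA drop_size_cat]; rewrite ?size_sort //;
  by rewrite perm_sym perm_sort.
apply: (sorted_eq leq_trans anti_leq); first by rewrite ltn_sorted_uniq_leq in sA; case/andP: sA.
- rewrite (sorted_pairwise leq_trans) pairwise_cat -!(sorted_pairwise leq_trans).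
  rewrite !sort_sorted ?andbT //; try exact: leq_total.
  by apply/allrelP=> x y; rewrite !mem_sort => xu yv; apply: ltnW; apply: (allrelP uv).
- by rewrite perm_sym; apply: perm_trans p; apply: perm_cat; rewrite perm_sort.
Qed.

(* The alphabets of the two sides of the maximum: either an initial and a final
   segment of [A], or these with the two letters at the cut exchanged. *)
Definition cut_left (A : seq nat) (c : bool * nat) :=
  if c.1 then rcons (take c.2.-1 A) (nth 0 A c.2) else take c.2 A.

Definition cut_right (A : seq nat) (c : bool * nat) :=
  if c.1 then nth 0 A c.2.-1 :: drop c.2.+1 A else drop c.2 A.

(** A pair [(b, p)] puts [p] letters on the left. The flag [b] is set when a block 21 straddles the
    cut, so that each side has a letter; read as a number, it counts the extra descent. *)
Definition cuts n := [seq (false, p) | p <- iota 0 n.+1]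
  ++ [seq (true, p) | p <- iota 1 n.-1].

Definition preimages (A : seq nat) : seq (seq nat) :=
  [seq w <- permutations A | layered (stack_sort w)].

(** For increasing [A] the head is the least letter. The default value 0 admits the empty word when
    [A] is empty. *)
Definition min_first A : seq (seq nat) :=
  [seq w <- preimages A | head 0 (stack_sort w) == head 0 A].

Definition preimages_right A c :=
  if c.1 then min_first (cut_right A c) else preimages (cut_right A c).

Lemma mem_cuts n c : (c \in cuts n) = if c.1 then (0 < c.2 < n) else (c.2 <= n).
Proof.
case: c => b p; rewrite /cuts mem_cat; apply/idP/idP.
  by case/orP=> /mapP[q]; rewrite mem_iota => q_in [-> ->] /=; lia.
by case: b => pn; apply/orP; [right | left]; apply/mapP; exists p => //;
  rewrite mem_iota; move: pn => /=; lia.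
Qed.

Lemma mem_preimages A w : (w \in preimages A) = perm_eq w A && layered (stack_sort w).
Proof. by rewrite mem_filter mem_permutations andbC. Qed.

Lemma swap_split (A : seq nat) p : 0 < p < size A ->
  A = take p.-1 A ++ [:: nth 0 A p.-1, nth 0 A p & drop p.+1 A].
Proof.
case: p => // p pA /=; rewrite -drop_nth // -drop_nth ?cat_take_drop //; lia.
Qed.

Lemma perm_cut_sides A c : c \in cuts (size A) -> perm_eq (cut_left A c ++ cut_right A c) A.
Proof.
rewrite mem_cuts /cut_left /cut_right; case: c => -[] p /= pA; last by rewrite cat_take_drop.
rewrite {5}(swap_split pA) cat_rcons perm_cat2l.
by rewrite -(cat1s (nth 0 A p)) -(cat1s (nth 0 A p.-1)) perm_catCA.
Qed.

Lemma size_cut_left A c : c \in cuts (size A) -> size (cut_left A c) = c.2.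
Proof.
rewrite mem_cuts /cut_left; case: c => -[] p /= pA.
  by rewrite size_rcons size_takel; lia.
by rewrite size_takel.
Qed.

Lemma size_cut_right A c : c \in cuts (size A) -> size (cut_right A c) = size A - c.2.
Proof.
move=> cA.
by rewrite -{1}(perm_size (perm_cut_sides cA)) size_cat size_cut_left // addKn.
Qed.

Lemma sorted_cut_left A c : c \in cuts (size A) -> sorted ltn A -> sorted ltn (cut_left A c).
Proof.
rewrite mem_cuts /cut_left; case: c => -[] p /= pA sA; last exact: take_sorted.
move: sA; rewrite {1}(swap_split pA) -cats1; apply: subseq_sorted; first exact: ltn_trans.
by apply: cat_subseq; rewrite ?subseq_refl // sub1seq !inE eqxx orbT.
Qed.

Lemma sorted_cut_right A c : c \in cuts (size A) -> sorted ltn A -> sorted ltn (cut_right A c).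
Proof.
rewrite mem_cuts /cut_right; case: c => -[] p /= pA sA; last exact: drop_sorted.
have sub : subseq (nth 0 A p.-1 :: drop p.+1 A) A.
  rewrite [X in subseq _ X](swap_split pA); apply: subseq_trans (suffix_subseq _ _).
  exact: (cat_subseq (subseq_refl [:: _]) (subseq_cons _ _)).
exact: (subseq_sorted ltn_trans sub sA).
Qed.

Lemma uniq_preimages A : uniq (preimages A).
Proof. by rewrite filter_uniq ?permutations_uniq. Qed.

Lemma uniq_preimages_right A c : uniq (preimages_right A c).
Proof. by rewrite /preimages_right; case: c.1; [apply/filter_uniq | ]; apply: uniq_preimages. Qed.

Lemma mem_preimages_right A c w : w \in preimages_right A c -> w \in preimages (cut_right A c).
Proof. by rewrite /preimages_right; case: c.1 => //; rewrite mem_filter => /andP[]. Qed.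


(** This is why the left side carries no further condition, even at a cut inside a block 21. *)
Lemma stack_sort_last (B L : seq nat) b : sorted ltn (rcons B b) -> perm_eq L (rcons B b) ->
  exists2 u, stack_sort L = rcons u b & perm_eq u B.
Proof.
move=> sB pL; have uL : uniq L by rewrite (perm_uniq pL) (sorted_uniq ltn_trans ltnn).
have := perm_stack_sort uL.
have [L1 [L2 [-> p]]] := max_cutP pL.
rewrite (stack_sort_cut sB p) cats1 => p'; exists (stack_sort L1 ++ stack_sort L2) => //.
have := perm_trans p' (_ : perm_eq _ (rcons B b)); rewrite perm_cut_max => /(_ p).
by rewrite perm_rcons perm_sym perm_rcons perm_cons perm_sym.
Qed.

Lemma swap_lt (A : seq nat) p : 0 < p < size A -> sorted ltn A ->
  [/\ nth 0 A p.-1 < nth 0 A p, all (ltn^~ (nth 0 A p.-1)) (take p.-1 A)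
    & all (ltn (nth 0 A p)) (drop p.+1 A)].
Proof.
move=> pA; rewrite {1}(swap_split pA) (sorted_pairwise ltn_trans) pairwise_cat /=.
case/and3P=> /allrelP Al _ /and3P[/andP[ab _] bD _]; split=> //.
by apply/allP => x /Al; apply; rewrite mem_head.
Qed.

(** At an ordinary cut the left letters lie below the right ones, so blocks and descents add up. At
    a swapped cut the left image ends with [nth 0 A c.2] and the right one begins with
    [nth 0 A c.2.-1]: they form a new block 21, whose descent is the summand [c.1]. *)
Lemma preimages_cut (A L R : seq nat) c : sorted ltn A -> c \in cuts (size A) ->
    L \in preimages (cut_left A c) -> R \in preimages_right A c ->
  [/\ perm_eq (L ++ R) A, layered (stack_sort L ++ stack_sort R)
    & des (stack_sort L ++ stack_sort R) = c.1 + des (stack_sort L) + des (stack_sort R)].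
Proof.
move=> sA cA Lg Rg; have := Lg; rewrite mem_preimages => /andP[pL lL].
have := mem_preimages_right Rg; rewrite mem_preimages => /andP[pR lR].
have sL := sorted_cut_left cA sA; have sR := sorted_cut_right cA sA.
have p : perm_eq (L ++ R) A := perm_trans (perm_cat pL pR) (perm_cut_sides cA).
have [uL uR] := perm_cat_uniq sA p.
have pL' := perm_trans (perm_stack_sort uL) pL.
have pR' := perm_trans (perm_stack_sort uR) pR.
case: c cA Lg Rg pL pR sL sR pL' pR' => -[] q cA Lg Rg pL pR sL sR pL' pR'.
  move: cA; rewrite mem_cuts /= => qA.
  have [ab Ba bD] := swap_lt qA sA.
  have [u Eu pu] := stack_sort_last sL pL.
  move: Rg; rewrite mem_filter /= => /andP[/eqP h _].
  move: pR' lR h; rewrite Eu; case: (stack_sort R) => [|a v] pR' lR; first by have := perm_size pR'.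
  move=> h; have {h} ha : a = nth 0 A q.-1 by [].
  move: pR' lR; rewrite {}ha -[cut_right A _]/(nth 0 A q.-1 :: drop q.+1 A) perm_cons => pv.
  rewrite layered_lt_cons; last by rewrite (perm_all _ pv); apply: sub_all bD => z;
    apply: ltn_trans.
  move=> lv; split=> //.
    apply: layered_swap => //; rewrite ?(perm_all _ pu) ?(perm_all _ pv) //.
    move: lL; rewrite Eu layered_rcons // (perm_all _ pu); apply: sub_all Ba => z /= za.
    exact: ltn_trans ab.
  by rewrite des_cat ab addnAC addnC addnA.
have lr : allrel ltn (stack_sort L) (stack_sort R).
  apply/allrelP => x y; rewrite (perm_mem pL') (perm_mem pR') => xL yR.
  move: sA; rewrite -(cat_take_drop q A) (sorted_pairwise ltn_trans) pairwise_cat.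
  by case/and3P=> /allrelP/(_ x y xL yR).
by rewrite layered_cat // lL lR des_cat_lt.
Qed.

(** The two alternatives of [layered_cat_max], applied between the images of [L] and [R], yield the
    two types of cut. *)
Lemma preimages_cutP A m w : sorted ltn (rcons A m) -> w \in preimages (rcons A m) ->
  exists c L R, [/\ c \in cuts (size A), L \in preimages (cut_left A c),
    R \in preimages_right A c & w = L ++ m :: R].
Proof.
move=> sAm; have sA := sorted_ltn_rcons sAm.
rewrite mem_preimages => /andP[pw]; have [L [R [-> p]]] := max_cutP pw.
have [uL uR] := perm_cat_uniq sA p.
have pL := perm_stack_sort uL; have pR := perm_stack_sort uR.
rewrite (stack_sort_cut sAm p) cats1 layered_rcons; last exact: stack_sort_cut_lt sAm p.
move=> lLR; have type1 : allrel ltn (stack_sort L) (stack_sort R) -> exists c L' R',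
    [/\ c \in cuts (size A), L' \in preimages (cut_left A c),
    R' \in preimages_right A c & L ++ m :: R = L' ++ m :: R'].
  move=> lr; move: lLR; rewrite layered_cat // => /andP[lL lR].
  have [|pL' pR'] := perm_cut sA p.
    by apply/allrelP=> x y xL yR; apply: (allrelP lr); rewrite (perm_mem pL, perm_mem pR).
  exists (false, size L), L, R; split; rewrite ?mem_preimages ?pL' ?pR' //.
  by rewrite mem_cuts /= -(perm_size p) size_cat leq_addr.
case EL: (stack_sort L) => [|x L']; first by apply: type1; rewrite EL.
have [B [b [sB pLB]]] : exists B b, sorted ltn (rcons B b) /\ perm_eq L (rcons B b).
  have := sort_sorted leq_total L; have := sort_uniq leq L; have /permPl := perm_sort leq L.
  case/lastP: (sort leq L) => [|B b].
    by move=> pL0; have := perm_size pL; rewrite -(perm_size pL0) EL.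
  rewrite uL => pB uB lB; exists B, b; rewrite perm_sym pB ltn_sorted_uniq_leq uB lB.
  by [].
have [u Eu pu] := stack_sort_last sB pLB.
case ER: (stack_sort R) => [|a v]; first by apply: type1; rewrite ER allrel0r.
have ub : all (ltn^~ b) u by rewrite (perm_all _ pu); apply/allP=> z; apply: mem_lt_max.
have lLR' : layered (rcons u b ++ a :: v) by rewrite -Eu -ER.
have [lr|[ab ua bv]] := layered_cat_max ub lLR'; first by apply: type1; rewrite Eu ER.
have av : all (ltn a) v by apply: sub_all bv => z; apply: ltn_trans.
have ubav : allrel ltn u [:: b, a & v].
  apply/allrelP=> y z /(allP ua) ya; rewrite !inE => /or3P[/eqP->|/eqP->//|/(allP bv) bz].
    exact: ltn_trans ab.
  exact: ltn_trans ya (ltn_trans ab bz).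
(* The letters [a < b] are neighbours in [A], exchanged by the cut. *)
have EA : A = sort leq u ++ [:: a, b & sort leq v].
  apply: (sorted_eq leq_trans anti_leq).
  - by rewrite ltn_sorted_uniq_leq in sA; case/andP: sA.
  - rewrite (sorted_pairwise leq_trans) pairwise_cat /= -!(sorted_pairwise leq_trans).
    rewrite !(sort_sorted leq_total) !all_sort (ltnW ab) /= !andbT; apply/and3P; split.
    + apply/allrelP=> y z; rewrite mem_sort => yu; rewrite !inE mem_sort => zabv.
      by apply: ltnW; apply: (allrelP ubav); rewrite // !inE orbCA.
    + by apply: sub_all av => z; apply: ltnW.
    + by apply: sub_all bv => z; apply: ltnW.
  - rewrite perm_sym; apply: perm_trans p; apply: perm_trans (perm_cat pL pR).
    rewrite Eu ER cat_rcons; apply: perm_cat; first by rewrite perm_sort.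
    rewrite -(cat1s a) -(cat1s b) perm_catCA /= !perm_cons; by rewrite perm_sort.
have su : size (sort leq u) = size u by rewrite size_sort.
(* Besides the letters of [u], the left side contains [b]. *)
exists (true, (size u).+1), L, R; split=> //.
- by rewrite mem_cuts EA size_cat size_sort /= !addnS !ltnS leq_addr.
- rewrite mem_preimages Eu layered_rcons // /cut_left /= EA -{1}su take_size_cat // nth_cat su.
  rewrite ltnNge leqnSn subSnn /=; apply/andP; split.
    by rewrite perm_sym; apply: perm_trans pL; rewrite Eu -!cats1 perm_cat2r perm_sort.
  by move: lLR'; rewrite cat_rcons layered_cat // => /andP[].
rewrite -[preimages_right _ _]/(min_first (cut_right A (true, (size u).+1))).
rewrite mem_filter mem_preimages ER.
have -> : cut_right A (true, (size u).+1) = a :: sort leq v.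
  rewrite /cut_right /= EA nth_cat su ltnn subnn /= drop_cat su ltnNge ltnW ?ltnS ?leqnSn //=.
  by rewrite subSn // subSnn /= drop0.
rewrite layered_lt_cons //; apply/and3P; split; first by [].
  by rewrite perm_sym; apply: perm_trans pR; rewrite ER perm_cons perm_sort.
move: lLR'; rewrite cat_rcons layered_cat // => /andP[_].
rewrite layered_cons2 /= [b < a]ltnNge ltnW //=.
by case/and3P.
Qed.

End Words.

(** * Enumeration of preimages and their generating polynomials *)

Lemma preimages_rcons (A : seq nat) m : sorted ltn (rcons A m) ->
  perm_eq (preimages (rcons A m))
    [seq x.1 ++ m :: x.2 | c <- cuts (size A),
       x <- [seq (L, R) | L <- preimages (cut_left A c), R <- preimages_right A c]].
Proof.
move=> sAm; have sA := sorted_ltn_rcons sAm; have mA := sorted_ltn_notin sAm.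
have mem_left c L : L \in preimages (cut_left A c) -> size L = size (cut_left A c).
  by rewrite mem_preimages => /andP[/perm_size].
have notinL c L R : c \in cuts (size A) -> L \in preimages (cut_left A c) ->
    R \in preimages_right A c -> m \notin L.
  move=> cA Lg Rg; have [p _ _] := preimages_cut sA cA Lg Rg.
  by apply: contra mA => mL; rewrite -(perm_mem p) mem_cat mL.
apply: uniq_perm; first exact: uniq_preimages.
  apply: allpairs_uniq_dep.
  - rewrite cat_uniq !map_inj_uniq ?iota_uniq //; try by move=> x y [].
    by rewrite andbT; apply/hasPn=> _ /mapP[p _ ->]; apply/negP => /mapP[].
  - move=> c _; apply: allpairs_uniq; rewrite ?uniq_preimages ?uniq_preimages_right //.
    by move=> [? ?] [? ?].
  move=> _ _ /allpairsPdep[c [x [cA + ->]]] /allpairsPdep[c' [x' [cA' + ->]]] /=.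
  move=> /allpairsP[[L R] /= [Lg Rg ->]] /allpairsP[[L' R'] /= [Lg' Rg' ->]] /=.
  (* As [m] does not occur in the left sides, the word determines [L], then [R]. *)
  move=> e; have eL : L = L'.
    have := congr1 (fun w => take (index m w) w) e.
    rewrite !index_cat (negPf (notinL _ _ _ cA Lg Rg)).
    by rewrite (negPf (notinL _ _ _ cA' Lg' Rg')) /= eqxx !addn0 !take_size_cat.
  move: e; rewrite {}eL in Lg *; move/eqP; rewrite eqseq_cat // eqxx /= => /eqP[eR].
  rewrite {}eR in Rg *; suff -> : c = c' by [].
  have sz : c.2 = c'.2.
    by rewrite -(size_cut_left cA) -(size_cut_left cA') -(mem_left _ _ Lg) -(mem_left _ _ Lg').
  have := Lg; have := Lg'; rewrite !mem_preimages => /andP[p' _] /andP[+ _].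
  rewrite perm_sym => p; have {p p'} := perm_trans p p'.
  (* At equal sizes an ordinary and a swapped left alphabet differ: only the swapped one contains
     [nth 0 A p]. *)
  have no p : (0 < p < size A)%N -> ~ perm_eq (cut_left A (true, p)) (cut_left A (false, p)).
    move=> /andP[p0 pA] /perm_mem/(_ (nth 0%N A p)); rewrite mem_rcons mem_head /=.
    by rewrite in_take ?mem_nth // index_uniq ?ltnn // (sorted_uniq ltn_trans ltnn).
  case: c c' sz cA cA' {Lg Lg' Rg Rg'} => [[] q] [[] q'] /= <- //; rewrite !mem_cuts /= => h h'.
    by move=> /(no _ h).
  by rewrite perm_sym => /(no _ h').
move=> w; apply/idP/idP => [/(preimages_cutP sAm)[c [L [R [cA Lg Rg ->]]]]|].
  apply/allpairsPdep; exists c, (L, R); split=> //.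
  by apply/allpairsP; exists (L, R).
case/allpairsPdep=> c [x [cA xg ->]].
move/allpairsP: xg => [[L R] /= [Lg Rg ->]] /=.
have [p l _] := preimages_cut sA cA Lg Rg.
rewrite mem_preimages perm_cut_max p (stack_sort_cut sAm p) cats1 layered_rcons //.
exact: stack_sort_cut_lt sAm p.
Qed.

(** The variable of [{poly rat}] is the y of the generating functions. *)
Definition weight (s : seq (seq nat)) : {poly rat} := \sum_(w <- s) 'X^(des (stack_sort w)).

Lemma des_rcons_max u m : all (ltn^~ m) u -> des (rcons u m) = des u.
Proof. by move=> um; rewrite -cats1 des_cat_lt ?allrel1r // addn0. Qed.

Lemma preimages_des (A : seq nat) m c L R : sorted ltn (rcons A m) -> c \in cuts (size A) ->
    L \in preimages (cut_left A c) -> R \in preimages_right A c ->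
  stack_sort (L ++ m :: R) = (stack_sort L ++ stack_sort R) ++ [:: m] /\
  des (stack_sort (L ++ m :: R)) = (c.1 + des (stack_sort L) + des (stack_sort R))%N.
Proof.
move=> sAm cA Lg Rg; have sA := sorted_ltn_rcons sAm.
have [p l <-] := preimages_cut sA cA Lg Rg.
have e := stack_sort_cut sAm p; split=> //; rewrite e cats1 des_rcons_max //.
exact: stack_sort_cut_lt sAm p.
Qed.

Lemma weight_preimages_rcons (A : seq nat) m : sorted ltn (rcons A m) ->
  weight (preimages (rcons A m)) =
    \sum_(c <- cuts (size A))
      'X^(c.1) * weight (preimages (cut_left A c)) * weight (preimages_right A c).
Proof.
move=> sAm; rewrite /weight (perm_big _ (preimages_rcons sAm)) big_allpairs_dep /=.
apply: eq_big_seq => c cA; rewrite big_allpairs_dep -mulrA big_distrlr mulr_sumr /=.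
apply: eq_big_seq => L Lg; rewrite mulr_sumr; apply: eq_big_seq => R Rg.
by have [_ ->] := preimages_des sAm cA Lg Rg; rewrite !exprD mulrA.
Qed.

Lemma stack_sort1 a : stack_sort [:: a] = [:: a].
Proof. exact: (@stack_sortE [::] [::] a). Qed.

Lemma size_stack_sort (w : seq nat) : uniq w -> size (stack_sort w) = size w.
Proof. by move=> uw; apply/perm_size/perm_stack_sort. Qed.

Lemma head_stack_sort_cut (A : seq nat) m c L R : sorted ltn (rcons A m) ->
    c \in cuts (size A) -> L \in preimages (cut_left A c) -> R \in preimages_right A c ->
    (0 < c.2)%N ->
  head 0%N (stack_sort (L ++ m :: R)) = head 0%N (stack_sort L).
Proof.
move=> sAm cA Lg Rg c0; have [-> _] := preimages_des sAm cA Lg Rg.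
have sA := sorted_ltn_rcons sAm.
have : size (stack_sort L) = c.2.
  move: Lg; rewrite mem_preimages => /andP[pL _].
  rewrite size_stack_sort ?(perm_size pL) ?size_cut_left //.
  by rewrite (perm_uniq pL) (sorted_uniq ltn_trans ltnn) // sorted_cut_left.
by case: (stack_sort L) => //= e; rewrite -e in c0.
Qed.

Lemma weight_filter (P : pred (seq nat)) s :
  weight [seq w <- s | P w] = \sum_(w <- s) if P w then 'X^(des (stack_sort w)) else 0.
Proof. by rewrite /weight big_filter big_mkcond. Qed.

(** The share of the cut [c] in the weight of [min_first (rcons A m)], for nonempty [A]. *)
Definition min_term (A : seq nat) m c : {poly rat} :=
  \sum_(L <- preimages (cut_left A c)) \sum_(R <- preimages_right A c)
    if head 0%N (stack_sort (L ++ m :: R)) == head 0%N A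
    then 'X^(des (stack_sort (L ++ m :: R))) else 0.

(** A nonempty left side supplies the first letter of the image, and its alphabet has the same least
    letter as [A] unless the cut is [(true, 1)], which exchanges the two smallest letters. *)
Lemma min_termE (A : seq nat) m c : sorted ltn (rcons A m) -> c \in cuts (size A) ->
    (0 < c.2)%N -> c != (true, 1%N) ->
  min_term A m c = 'X^(c.1) * weight (min_first (cut_left A c)) * weight (preimages_right A c).
Proof.
move=> sAm cA c0 c1; rewrite weight_filter -mulrA big_distrlr mulr_sumr /=.
apply: eq_big_seq => L Lg; rewrite mulr_sumr; apply: eq_big_seq => R Rg.
have [_ ->] := preimages_des sAm cA Lg Rg; rewrite (head_stack_sort_cut sAm cA Lg Rg) //.
have -> : head 0%N (cut_left A c) = head 0%N A.
  by case: c c0 c1 {cA Lg Rg} => [[] [|[|p]]] //; case: A {sAm}.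
by case: ifP => _; rewrite ?mul0r ?mulr0 // !exprD mulrA.
Qed.

(** The left side is the second smallest letter alone, and the image begins with it. *)
Lemma min_term_true1 (A : seq nat) m : sorted ltn (rcons A m) -> (1 < size A)%N ->
  min_term A m (true, 1%N) = 0.
Proof.
move=> sAm A1; have cA : (true, 1%N) \in cuts (size A) by rewrite mem_cuts.
rewrite /min_term big_seq big1 // => L Lg; rewrite big_seq big1 // => R Rg.
rewrite (head_stack_sort_cut sAm cA Lg Rg) //; case: eqP => // hL.
have sA := sorted_ltn_rcons sAm; have := Lg; rewrite mem_preimages => /andP[pL _].
have pL1 : perm_eq L [:: nth 0%N A 1] by move: pL; rewrite /cut_left /= take0.
move: hL; rewrite (perm_small_eq _ pL1) // stack_sort1.
have [] := swap_lt (p := 1) _ sA; first by rewrite A1.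
by rewrite [_.-1]/= nth0 => lt _ _ /= h; rewrite h ltnn in lt.
Qed.

Lemma min_term0 (A : seq nat) m : sorted ltn (rcons A m) -> (0 < size A)%N ->
  min_term A m (false, 0%N) = weight (min_first A).
Proof.
move=> sAm A0; have cA : (false, 0%N) \in cuts (size A) by rewrite mem_cuts.
rewrite weight_filter /min_term.
have -> : preimages_right A (false, 0%N) = preimages A.
  by rewrite /preimages_right /cut_right /= drop0.
have -> : preimages (cut_left A (false, 0%N)) = [:: [::]] by rewrite /cut_left /= take0.
rewrite big_seq1; apply: eq_big_seq => R Rg.
have Lg : [::] \in preimages (cut_left A (false, 0%N)) by rewrite /cut_left /= take0.
have Rg' : R \in preimages_right A (false, 0%N) by rewrite /preimages_right /cut_right /= drop0.
have [-> ->] := preimages_des sAm cA Lg Rg'.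
rewrite [stack_sort [::] ++ _]/= [(_ + _ + _)%N]/=.
suff : size (stack_sort R) != 0%N by case: (stack_sort R).
move: Rg; rewrite mem_preimages => /andP[pR _]; rewrite size_stack_sort ?(perm_size pR) -?lt0n //.
by rewrite (perm_uniq pR) (sorted_uniq ltn_trans ltnn) // (sorted_ltn_rcons sAm).
Qed.

Lemma big_cuts n (F : bool * nat -> {poly rat}) :
  \sum_(c <- cuts n) F c =
    \sum_(0 <= p < n.+1) F (false, p) + \sum_(1 <= p < n) F (true, p).
Proof. by rewrite big_cat !big_map /index_iota subn0 subn1. Qed.

(** The empty left side leaves all of [A] on the right and gives the first term. The cut [(true, 1)]
    contributes nothing, so the last sum starts at 2; this is the source of the factor G - x. *)
Lemma weight_min_first_rcons (A : seq nat) m : sorted ltn (rcons A m) -> (0 < size A)%N ->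
  weight (min_first (rcons A m)) = weight (min_first A) +
    \sum_(1 <= p < (size A).+1)
      weight (min_first (cut_left A (false, p))) * weight (preimages (cut_right A (false, p))) +
    \sum_(2 <= p < size A)
      'X * weight (min_first (cut_left A (true, p))) * weight (min_first (cut_right A (true, p))).
Proof.
move=> sAm A0; rewrite weight_filter (perm_big _ (preimages_rcons sAm)) big_allpairs_dep /=.
under eq_bigr => c _ do rewrite big_allpairs_dep /=.
have -> : head 0%N (rcons A m) = head 0%N A by case: A A0 {sAm}.
rewrite -[LHS]/(\sum_(c <- cuts (size A)) min_term A m c) big_cuts.
rewrite [X in X + _ = _]big_ltn // min_term0 //; congr (_ + _ + _).
  apply: eq_big_nat => p /andP[p0 pA]; rewrite min_termE // ?mul1r //.
  by rewrite mem_cuts /= -ltnS.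
have [le1|gt1] := leqP (size A) 1; first by rewrite !big_geq // ltnW.
rewrite [LHS]big_ltn // min_term_true1 // add0r.
apply: eq_big_nat => p /andP[p0 pA]; rewrite min_termE //.
- by rewrite mem_cuts /= pA ltnW.
- exact: ltnW.
- by rewrite xpair_eqE /= gtn_eqF.
Qed.

Lemma preimages1 a : preimages [:: a] = [:: [:: a]].
Proof.
by rewrite -[LHS]/(if layered (stack_sort [:: a]) then [:: [:: a]] else [::]) stack_sort1.
Qed.

(** Instead of relabelling words, the recursions at the largest letter are run on both alphabets,
    which enter only through their sizes. Each recursion calls both weights, so the two claims are
    proved together. *)
Lemma weight_size (A B : seq nat) : sorted ltn A -> sorted ltn B -> size A = size B ->
  weight (preimages A) = weight (preimages B) /\ weight (min_first A) = weight (min_first B).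
Proof.
move En: (size A) => n; elim/ltn_ind: n A B En => n IH A B.
case/lastP: A => [|A m] En sAm; case/lastP: B => [|B m'] sBm.
- by [].
- by rewrite -En size_rcons.
- by rewrite -En size_rcons.
rewrite size_rcons => sB; have sz : size A = size B by move: En sB; rewrite size_rcons; lia.
have szn : (size A < n)%N by rewrite sz sB.
have sA := sorted_ltn_rcons sAm; have sB' := sorted_ltn_rcons sBm.
have left c : c \in cuts (size A) ->
    weight (preimages (cut_left A c)) = weight (preimages (cut_left B c)) /\
    weight (min_first (cut_left A c)) = weight (min_first (cut_left B c)).
  move=> cA; have cB : c \in cuts (size B) by rewrite -sz.
  apply: (IH c.2); rewrite ?sorted_cut_left ?size_cut_left //.
  rewrite -(size_cut_left cA) (leq_ltn_trans _ szn) //.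
  by rewrite -(perm_size (perm_cut_sides cA)) size_cat leq_addr.
have right c : c \in cuts (size A) ->
    weight (preimages (cut_right A c)) = weight (preimages (cut_right B c)) /\
    weight (min_first (cut_right A c)) = weight (min_first (cut_right B c)).
  move=> cA; have cB : c \in cuts (size B) by rewrite -sz.
  apply: (IH (size A - c.2)%N); rewrite ?sorted_cut_right ?size_cut_right ?sz //.
  by rewrite -sz (leq_ltn_trans _ szn) // leq_subr.
split.
  rewrite !weight_preimages_rcons // -sz; apply: eq_big_seq => c cA.
  have [-> _] := left c cA; have [r1 r2] := right c cA; congr (_ * _).
  by rewrite /preimages_right; case: c.1.
(* The recursion for [min_first] starts from a nonempty [A]; one-letter alphabets are treated
   directly. *)
have [A0|A0] := posnP (size A).
  have := sz; rewrite A0 => /esym/size0nil ->; rewrite (size0nil A0).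
  by rewrite !weight_filter !preimages1 !big_seq1 !stack_sort1 /= !eqxx.
rewrite !weight_min_first_rcons // -?sz //; congr (_ + _ + _).
- by have [_] := IH _ szn A B erefl sA sB' sz.
- apply: eq_big_nat => p /andP[p0 pA].
  have cA : (false, p) \in cuts (size A) by rewrite mem_cuts /= -ltnS.
  by have [_ ->] := left _ cA; have [->] := right _ cA.
- apply: eq_big_nat => p /andP[p0 pA].
  have cA : (true, p) \in cuts (size A) by rewrite mem_cuts /= pA ltnW.
  by have [_ ->] := left _ cA; have [_ ->] := right _ cA.
Qed.

(** * Recurrences for the weights, indexed by length *)

Definition preimages_weight n := weight (preimages (iota 1 n)).
Definition min_first_weight n := weight (min_first (iota 1 n)).

Lemma iota1S n : iota 1 n.+1 = rcons (iota 1 n) n.+1.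
Proof. by rewrite -[in LHS](addn1 n) iotaD -cats1. Qed.

Lemma weight_preimagesE A : sorted ltn A -> weight (preimages A) = preimages_weight (size A).
Proof.
by move=> sA; have [] := weight_size sA (iota_ltn_sorted 1 _) (esym (size_iota 1 _)).
Qed.

Lemma weight_min_firstE A : sorted ltn A -> weight (min_first A) = min_first_weight (size A).
Proof.
by move=> sA; have [] := weight_size sA (iota_ltn_sorted 1 _) (esym (size_iota 1 _)).
Qed.

Lemma preimages_weight0 : preimages_weight 0 = 1.
Proof. by rewrite /preimages_weight /weight /= big_seq1. Qed.

Lemma preimages_weightS n : preimages_weight n.+1 =
  \sum_(0 <= p < n.+1) preimages_weight p * preimages_weight (n - p) +
  \sum_(1 <= p < n) 'X * preimages_weight p * min_first_weight (n - p).
Proof.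
have sn := iota_ltn_sorted 1 n.+1; have sz := size_iota 1 n.
have so := iota_ltn_sorted 1 n.
rewrite iota1S in sn; rewrite {1}/preimages_weight iota1S weight_preimages_rcons // big_cuts sz.
congr (_ + _); apply: eq_big_nat => p /andP[p0 pn].
  have c : (false, p) \in cuts (size (iota 1 n)) by rewrite mem_cuts sz /= -ltnS.
  rewrite mul1r !weight_preimagesE ?sorted_cut_left ?sorted_cut_right //.
  by rewrite size_cut_left // size_cut_right // sz.
have c : (true, p) \in cuts (size (iota 1 n)) by rewrite mem_cuts sz /= p0.
rewrite weight_preimagesE ?weight_min_firstE ?sorted_cut_left ?sorted_cut_right //.
by rewrite size_cut_left // size_cut_right // sz.
Qed.

Lemma min_first_weight1 : min_first_weight 1 = 1.
Proof. by rewrite /min_first_weight weight_filter preimages1 big_seq1 stack_sort1. Qed.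

Lemma min_first_weightS n : (0 < n)%N -> min_first_weight n.+1 = min_first_weight n +
  \sum_(1 <= p < n.+1) min_first_weight p * preimages_weight (n - p) +
  \sum_(2 <= p < n) 'X * min_first_weight p * min_first_weight (n - p).
Proof.
move=> n0; have sn := iota_ltn_sorted 1 n.+1; have sz := size_iota 1 n.
have so := iota_ltn_sorted 1 n.
rewrite iota1S in sn; rewrite {1}/min_first_weight iota1S weight_min_first_rcons ?sz //.
congr (_ + _ + _); apply: eq_big_nat => p /andP[p0 pn].
  have c : (false, p) \in cuts (size (iota 1 n)) by rewrite mem_cuts sz /= -ltnS.
  rewrite weight_preimagesE ?weight_min_firstE ?sorted_cut_left ?sorted_cut_right //.
  by rewrite size_cut_left // size_cut_right // sz.
have c : (true, p) \in cuts (size (iota 1 n)) by rewrite mem_cuts sz /= pn ltnW.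
rewrite !weight_min_firstE ?sorted_cut_left ?sorted_cut_right //.
by rewrite size_cut_left // size_cut_right // sz.
Qed.

(** * Congruences modulo a power of x, and elimination of G *)

Definition eqmodXn {K : nzRingType} N (p q : {poly K}) := exists r, p = q + r * 'X^N.


(** Truncated polynomials stand in for power series. The coefficientwise form is what the
    recurrences give; the explicit cofactor lets congruences be combined by [ring]. *)
Lemma eqmodXnP (K : nzRingType) N (p q : {poly K}) :
  (forall i, (i < N)%N -> p`_i = q`_i) <-> eqmodXn N p q.
Proof.
split=> [epq|[r ->] i iN]; last by rewrite coefD coefMXn iN addr0.
exists (drop_poly N (p - q)).
rewrite -[LHS](subrK q) -{1}[p - q](poly_take_drop N) addrC; congr (_ + _).
rewrite [take_poly _ _](_ : _ = 0) ?add0r //; apply/polyP=> i.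
by rewrite coef_take_poly coefB coef0; case: ifP => // /epq ->; rewrite subrr.
Qed.

(* Cross-multiplying the two equations gives [H - G = x y G H], after which
   [G] can be eliminated. *)
Lemma eliminate_G (K : comNzRingType) N (y : K) (H G : {poly K}) :
    eqmodXn N.+1 H ('X * ((1 + H) ^+ 2 + y%:P * H * G)) ->
    eqmodXn N.+1 G ('X * (1 + G + G * (1 + H) + y%:P * (G - 'X) * G)) ->
  eqmodXn N.+1 H ('X * ((1 + H) ^+ 2 * (1 + 'X * y%:P * H))).
Proof.
rewrite /eqmodXn (exprS 'X N); move: ('X^N : {poly K}) => Z [r eH] [t eG].
have eX : 'X * (H - G - 'X * y%:P * G * H) = 'X * ((G * r - H * t) * Z).
  pose rhsH := 'X * ((1 + H) ^+ 2 + y%:P * H * G) + r * ('X * Z).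
  pose rhsG := 'X * (1 + G + G * (1 + H) + y%:P * (G - 'X) * G) + t * ('X * Z).
  have h : H * rhsG - G * rhsH = 0 by rewrite /rhsG /rhsH -eG -eH; ring.
  by apply/eqP; rewrite -subr_eq0 -[X in _ == X]h /rhsG /rhsH; apply/eqP; ring.
(* Cancelling ['X] loses one order of precision; it is regained below, where this relation enters
   multiplied by ['X]. *)
have {}eX : H - G - 'X * y%:P * G * H = (G * r - H * t) * Z.
  apply/polyP=> i.
  by have := congr1 (fun p : {poly K} => p`_i.+1) eX; rewrite !coefXM.
exists ((1 + 'X * y%:P * H) * r - y%:P * H * (G * r - H * t)).
apply/eqP; rewrite -subr_eq0; apply/eqP.
pose rhsH := 'X * ((1 + H) ^+ 2 + y%:P * H * G) + r * ('X * Z).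
(* Multiplying the equation of [H] by 1 + x y H and subtracting x y H times the relation removes
   every [G]. *)
transitivity ((H - rhsH) * (1 + 'X * y%:P * H) + 'X * y%:P * H *
  ((G * r - H * t) * Z - (H - G - 'X * y%:P * G * H))).
  by rewrite /rhsH; ring.
by rewrite /rhsH -eH eX !subrr mul0r mulr0 addr0.
Qed.

(* With [n = m + k], this is the coefficient of [x^n y^k] in [H^j]. *)
Definition hcoef (m k j : nat) : rat :=
  if m is 0%N then ((k == 0%N) && (j == 0%N))%:R
  else (j%:R / m%:R * 'C(m, k)%:R * 'C(2 * m, m + k + j)%:R)%R.

(** * Binomial identities for the recursion satisfied by [hcoef] *)

Lemma mul_bin_left_rat n r :
  (r%:R + 1) * 'C(n, r.+1)%:R = (n%:R - r%:R) * 'C(n, r)%:R :> rat.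
Proof.
rewrite natr1 -natrM mul_bin_left; have [le|lt] := leqP r n.
  by rewrite natrM natrB.
by rewrite bin_small // muln0 mulr0.
Qed.

Lemma bin_double_step m r :
  'C(2 * m.+1, r.+2)%:R =
  'C(2 * m, r.+2)%:R + 2 * 'C(2 * m, r.+1)%:R + 'C(2 * m, r)%:R :> rat.
Proof. by rewrite mulnS !addSn add0n !binS !natrD; ring. Qed.

Lemma bin_double_diff m r :
  (m%:R + 1) * ('C(2 * m, r.+2)%:R - 'C(2 * m, r)%:R) =
  (m%:R - 1 - r%:R) * 'C(2 * m.+1, r.+2)%:R :> rat.
Proof.
have := mul_bin_left_rat (2 * m) r; have := mul_bin_left_rat (2 * m) r.+1.
rewrite bin_double_step natrM -natr1.
move: ('C(_, r)%:R : rat) ('C(_, r.+1)%:R : rat) ('C(_, r.+2)%:R : rat) => a b c e2 e1.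
apply/eqP; rewrite -subr_eq0; apply/eqP.
transitivity ((r%:R + 1 + 1) * c - (2 * m%:R - (r%:R + 1)) * b
  + ((r%:R + 1) * b - (2 * m%:R - r%:R) * a)); first by ring.
by rewrite e1 e2; ring.
Qed.

Lemma hcoefS0 m k : hcoef m.+1 k 0 = 0.
Proof. by rewrite /hcoef !mul0r. Qed.

(** The contribution of H^j (1 + H)^2. *)
Definition hstep m k j : rat :=
  hcoef m k j + 2 * hcoef m k j.+1 + hcoef m k j.+2.

(** With r = m + k + j, the factors j, 2(j + 1), j + 2 on the binomials at r, r + 1, r + 2 amount to
    j + 1 times the Pascal sum plus the difference of the outer two; [bin_double_step] and
    [bin_double_diff] reduce both to one binomial. *)
Lemma hstepE m k j : (0 < m)%N ->
  m%:R * (m%:R + 1) * hstep m k j =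
  'C(m, k)%:R * ((j%:R + 1) * (m%:R + 1) + (m%:R - 1 - (m + k + j)%:R))
   * 'C(2 * m.+1, (m + k + j).+2)%:R.
Proof.
move=> m0; rewrite /hstep /hcoef; case: m m0 => // m _; set M := m.+1.
have M0 : M%:R != 0 :> rat by rewrite pnatr_eq0.
rewrite !addnS; set r := (M + k + j)%N.
have d := bin_double_diff M r; have s := bin_double_step M r.
transitivity ('C(M, k)%:R * ((j%:R + 1) * (M%:R + 1) * 'C(2 * M.+1, r.+2)%:R
   + (M%:R - 1 - r%:R) * 'C(2 * M.+1, r.+2)%:R) : rat); last by ring.
by rewrite -d s -!(natr1 j.+1) -!(natr1 j); field.
Qed.

(** This mirrors H^(j+1) = x H^j (1 + H)^2 (1 + x y H). For positive [m] both [hstep] terms carry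
    the same binomial of upper index [2 * m.+1], and the rest follows from the ratio of neighbouring
    binomials in row [m]. *)
Lemma hcoefS m k j :
  hcoef m.+1 k j.+1 =
    hstep m k j + (if k is k'.+1 then hstep m k' j.+1 else 0).
Proof.
(* [hcoef 0] is defined by cases; here both sides are 1 at k = j = 0 and vanish elsewhere. *)
case: m => [|m].
  have z : forall k' j', hcoef 0 k' j'.+1 = 0 by case=> [|?] [|?].
  case: k => [|k]; rewrite /hstep !z ?mulr0 ?addr0.
    case: j => [|j]; first by rewrite /hcoef /= divr1 !mul1r.
    by rewrite z /hcoef (@bin_small (2 * 1)) ?mulr0 //; lia.
  by rewrite /hcoef (@bin_small (2 * 1)) ?mulr0 //; lia.
set M := m.+1; have M0 : M%:R != 0 :> rat by rewrite pnatr_eq0.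
have M1 : M%:R + 1 != 0 :> rat by rewrite natr1 pnatr_eq0.
apply: (mulfI (mulf_neq0 M0 M1)); rewrite [RHS]mulrDr hstepE //.
rewrite [hcoef _ _ _]/hcoef -[m.+1.+1]/M.+1.
rewrite (_ : (M.+1 + k + j.+1 = (M + k + j).+2)%N); last by lia.
case: k => [|k].
  move: ('C(2 * M.+1, _)%:R : rat) => T.
  by rewrite !bin0 mulr0 addr0 addn0 natrD -(natr1 M) -(natr1 j); field.
rewrite hstepE // (_ : (M + k + j.+1 = M + k.+1 + j)%N); last by lia.
have := mul_bin_left_rat M k.
clearbody M; move: ('C(2 * M.+1, _)%:R : rat) => T.
rewrite (binS M k) !natrD -(natr1 M) -!(natr1 j) -!(natr1 k).
move: ('C(M, k)%:R : rat) ('C(M, k.+1)%:R : rat) => a b e.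
apply/eqP; rewrite -subr_eq0; apply/eqP.
transitivity (((k%:R + 1) * b - (M%:R - k%:R) * a) * T); first by field.
by rewrite e subrr mul0r.
Qed.

(** With m = n - k, use (n + 1) C(2m, n + 1) = (m - k) C(2m, n) and (m - k) C(m, k) = m C(m - 1,
    k). *)
Lemma hcoef1 n k : (k < n)%N ->
  hcoef (n - k) k 1 =
  1 / (n.+1)%:R * ('C(n - k - 1, k))%:R * ('C(2 * n - 2 * k, n))%:R.
Proof.
move=> kn; rewrite -mulnBr; set m := (n - k)%N.
have -> : n = (m + k)%N by rewrite subnK // ltnW.
have m0 : (0 < m)%N by rewrite subn_gt0.
case: m m0 => // m _; rewrite /hcoef subn1 /= addn1.
set M := m.+1.
have e1 := mul_bin_left_rat (2 * M) (M + k).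
have e2 : (M%:R - k%:R) * 'C(M, k)%:R = M%:R * 'C(m, k)%:R :> rat.
  by rewrite -mul_bin_left_rat natr1 -!natrM -mul_bin_diag.
have M0 : M%:R != 0 :> rat by rewrite pnatr_eq0.
have Mk0 : (M + k).+1%:R != 0 :> rat by rewrite pnatr_eq0.
rewrite div1r div1r.
apply: (mulfI (mulf_neq0 M0 Mk0)).
transitivity ('C(M, k)%:R * (((M + k)%:R + 1) * 'C(2 * M, (M + k).+1)%:R) : rat).
  by rewrite natr1; field; apply: M0.
rewrite e1.
transitivity ((M%:R * 'C(m, k)%:R) * 'C(2 * M, M + k)%:R : rat); last first.
  by field; rewrite addrC -natrD natr1; apply: Mk0.
by rewrite -e2 natrM natrD; ring.
Qed.

(* The powers of a solution of [H = x (1 + H)^2 (1 + x y H)] satisfy a linear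
   recursion, which determines all their coefficients together. *)
Lemma pow_coefS (K : comNzRingType) N (y : K) (H : {poly K}) n j :
    eqmodXn N H ('X * ((1 + H) ^+ 2 * (1 + 'X * y%:P * H))) -> (n.+1 < N)%N ->
  (H ^+ j.+1)`_n.+1 =
    (H ^+ j)`_n + (H ^+ j.+1)`_n *+ 2 + (H ^+ j.+2)`_n +
    (if n is n'.+1 then
      y * ((H ^+ j.+1)`_n' + (H ^+ j.+2)`_n' *+ 2 + (H ^+ j.+3)`_n')
     else 0).
Proof.
move=> [q eH] nN.
rewrite [in LHS](_ : H ^+ j.+1 = 'X * (H ^+ j + H ^+ j.+1 *+ 2 + H ^+ j.+2
   + 'X * (y%:P * (H ^+ j.+1 + H ^+ j.+2 *+ 2 + H ^+ j.+3)))
   + H ^+ j * q * 'X^N); last first.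
  by rewrite exprS {1}eH !exprS; ring.
rewrite coefD coefMXn nN addr0 coefXM [LHS]/= !(mulr2n, coefD) coefXM.
congr (_ + _).
by case: n {nN} => // n; rewrite [LHS]/= coefCM !(mulr2n, coefD).
Qed.

(** In the equation of H each y comes with an x, and each factor H brings a further x, so only the
    constant term of H^0 escapes. This settles m = 0 in [pow_coefE] and the range n <= k of the
    count. *)
Lemma pow_coef_high N (H : {poly {poly rat}}) n k j :
    eqmodXn N H ('X * ((1 + H) ^+ 2 * (1 + 'X * ('X)%:P * H))) ->
    H`_0 = 0 -> (n < N)%N -> (n <= k)%N -> (0 < n + k + j)%N ->
  (H ^+ j)`_n`_k = 0.
Proof.
move=> eH H0; elim/ltn_ind: n k j => -[|n] IH k j nN nk pos.
  case: j pos => [|j]; last by rewrite exprS coef0M H0 mul0r coef0.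
  by rewrite addn0 add0n expr0 coef1 /= coef1; case: k nk.
case: j pos => [_|j _]; first by rewrite expr0 coef1 coef0.
have low j' : (H ^+ j')`_n`_k = 0 by apply: IH; lia.
rewrite (pow_coefS _ eH) // !(mulr2n, coefD) !low !add0r.
case: n IH nN nk {low} => [|n] IH nN nk; first by rewrite coef0.
case: k nk => // k nk; rewrite coefXM [LHS]/= !(mulr2n, coefD).
by rewrite !IH ?addr0 //; lia.
Qed.

(** Every term of the recursion lowers [m] by one, while [k] stays or drops by one and [j] varies;
    hence the induction on [m] with [k] and [j] general. *)
Lemma pow_coefE N (H : {poly {poly rat}}) m k j :
    eqmodXn N H ('X * ((1 + H) ^+ 2 * (1 + 'X * ('X)%:P * H))) ->
    H`_0 = 0 -> (m + k < N)%N ->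
  (H ^+ j)`_(m + k)`_k = hcoef m k j.
Proof.
move=> eH H0; elim: m k j => [|m IH] k j kN.
  have [z|] := posnP (k + j).
    have [-> ->] : k = 0%N /\ j = 0%N by lia.
    by rewrite expr0 coef1 coef1.
  move=> p; rewrite (pow_coef_high eH) //; last by lia.
  by rewrite /hcoef -addn_eq0 eqn0Ngt p.
case: j => [|j]; first by rewrite expr0 coef1 coef0 hcoefS0.
rewrite addSn (pow_coefS _ eH) // !(mulr2n, coefD).
rewrite hcoefS /hstep !mulr_natl !(IH, mulr2n) ?(ltnW kN) //; congr (_ + _).
case: k kN => [|k] kN.
  by case: (m + 0)%N => [|n]; rewrite ?coef0 // coefXM.
rewrite addnS coefXM [LHS]/= !(mulr2n, coefD).
by rewrite !IH ?mulrDl ?mul1r //; lia.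
Qed.

(** * The generating polynomials and the final count *)

Lemma big_nat_trim (V : zmodType) (F : nat -> V) n : F 0%N = 0 -> F n = 0 ->
  \sum_(0 <= j < n.+1) F j = \sum_(1 <= j < n) F j.
Proof.
move=> F0 Fn; rewrite big_nat_recr //= Fn addr0.
by case: n Fn => [|n] _; [rewrite !big_geq | rewrite big_ltn // F0 add0r].
Qed.

(** Both weights are 1 at length 0, from the empty word, whereas H and G have no constant term. *)
Definition pos_part (f : nat -> {poly rat}) i := if i is 0%N then 0 else f i.

(** In [{poly {poly rat}}] the outer variable is x, and y is the constant [('X)%:P]. *)
Definition Hpoly N : {poly {poly rat}} := \poly_(i < N) pos_part preimages_weight i.
Definition Gpoly N : {poly {poly rat}} := \poly_(i < N) pos_part min_first_weight i.

Lemma coef_1H N i : (i < N)%N -> (1 + Hpoly N)`_i = preimages_weight i.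
Proof.
by move=> iN; rewrite coefD coef1 coef_poly iN; case: i iN => [|i] _;
  rewrite ?preimages_weight0 ?addr0 ?add0r.
Qed.

Lemma coefM_nat (p q : {poly {poly rat}}) n (f g : nat -> {poly rat}) :
    (forall i, (i <= n)%N -> p`_i = f i) -> (forall i, (i <= n)%N -> q`_i = g i) ->
  (p * q)`_n = \sum_(0 <= j < n.+1) f j * g (n - j)%N.
Proof.
move=> pf qg; rewrite coefM big_mkord; apply: eq_bigr => j _.
by rewrite pf ?qg ?leq_subr // -ltnS.
Qed.

Lemma Hpoly_eq N :
  eqmodXn N (Hpoly N)
    ('X * ((1 + Hpoly N) ^+ 2 + ('X)%:P * Hpoly N * Gpoly N)).
Proof.
apply/eqmodXnP => -[|n] nN; rewrite coefXM coef_poly nN //= preimages_weightS coefD.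
have le i : (i <= n)%N -> (i < N)%N by move=> lin; apply: leq_ltn_trans (ltnW nN).
rewrite expr2 (coefM_nat (f := preimages_weight) (g := preimages_weight));
  first congr (_ + _); last 2 first.
- by move=> i /le; apply: coef_1H.
- by move=> i /le; apply: coef_1H.
rewrite (coefM_nat (f := fun i => 'X * pos_part preimages_weight i)
  (g := pos_part min_first_weight)).
- rewrite big_nat_trim /= ?mulr0 ?mul0r ?subnn ?mulr0 //.
  apply: eq_big_nat => -[|j] // /andP[_ jn]; rewrite /=.
  by case: (n - j.+1)%N (subn_gt0 j.+1 n) => //; rewrite jn.
- by move=> i /le iN; rewrite coefCM coef_poly iN.
- by move=> i /le iN; rewrite coef_poly iN.
Qed.

Lemma Gpoly_eq N :
  eqmodXn N (Gpoly N)
    ('X * (1 + Gpoly N + Gpoly N * (1 + Hpoly N) + ('X)%:P * (Gpoly N - 'X) * Gpoly N)).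
Proof.
apply/eqmodXnP => -[|n] nN; rewrite coefXM coef_poly nN // [LHS]/= [RHS]/= !coefD.
have le i : (i <= n)%N -> (i < N)%N by move=> lin; apply: leq_ltn_trans (ltnW nN).
have Gi i : (i <= n)%N -> (Gpoly N)`_i = pos_part min_first_weight i.
  by move=> /le iN; rewrite coef_poly iN.
rewrite (coefM_nat (f := pos_part min_first_weight) (g := preimages_weight)) //; last first.
  by move=> i /le; apply: coef_1H.
(* The subtracted indicator comes from the ['X] in [Gpoly N - 'X]. *)
rewrite (coefM_nat (f := fun i => 'X * (pos_part min_first_weight i - (i == 1%N)%:R))
  (g := pos_part min_first_weight)) //; last first.
  by move=> i lin; rewrite coefCM coefB coefX Gi.
rewrite coef1 Gi //.
case: n nN le Gi => [|n] nN le Gi.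
  by rewrite min_first_weight1 !big_nat1 /= subrr mulr0 !mul0r !addr0.
rewrite min_first_weightS // add0r; congr (_ + _ + _).
  rewrite [RHS]big_ltn // mul0r add0r; apply: eq_big_nat => -[|j] //.
rewrite big_nat_trim /= ?subr0 ?mulr0 ?mul0r ?subnn ?mulr0 //.
have [->|n0] := posnP n; first by rewrite !big_geq.
(* The term at 1 vanishes, matching the sum that starts at 2 in [min_first_weightS]. *)
rewrite [RHS]big_ltn //= min_first_weight1 subrr mulr0 mul0r add0r.
apply: eq_big_nat => -[|[|j]] // /andP[_ jn]; rewrite /= subr0.
by case: (n.+1 - j.+2)%N (subn_gt0 j.+2 n.+1) => //; rewrite jn.
Qed.

Lemma coef_preimages_weight n k : (preimages_weight n)`_k =
  (size [seq w <- preimages (iota 1 n) | des (stack_sort w) == k])%:R.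
Proof.
rewrite /preimages_weight /weight coef_sum size_filter -sum1_count natr_sum big_mkcond /=.
by rewrite [RHS]big_mkcond; apply: eq_bigr => w _; rewrite coefXn eq_sym; case: eqP.
Qed.

Lemma coef_preimages_weightE n k : (0 < n)%N -> (preimages_weight n)`_k =
  1 / (n.+1)%:R * ('C(n - k - 1, k))%:R * ('C(2 * n - 2 * k, n))%:R.
Proof.
move=> n0; have eH := eliminate_G (@Hpoly_eq n.+1) (@Gpoly_eq n.+1).
have H0 : (Hpoly n.+1)`_0 = 0 by rewrite coef_poly.
have -> : preimages_weight n = (Hpoly n.+1 ^+ 1)`_n.
  by rewrite expr1 coef_poly ltnSn; case: (n) n0.
have [kn|nk] := ltnP k n.
  rewrite -hcoef1 //; have := pow_coefE 1 eH H0 (m := n - k) (k := k).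
  by rewrite subnK ?ltnSn; [apply | apply: ltnW].
rewrite (pow_coef_high eH) //; last by rewrite addn1.
by rewrite (eqP nk) sub0n bin_small ?mulr0 ?mul0r // (leq_trans n0).
Qed.

Unset Implicit Arguments.

(* With natural-number subtraction, the binomial coefficients vanish exactly
   as in the stated convention: if n - k - 1 is negative then 0 < k and
   'C(0, k) = 0. *)
Theorem theorem5p1 (n k : nat) (hn : (1 <= n)%N) :
  let A := stack_preimage (Avk n k [:: [:: 2; 3; 1]; [:: 3; 1; 2]; [:: 3; 2; 1]]%N) in
  finite_set A /\
  (#|` fset_set A|%fset)%:R =
    1 / (n.+1)%:R * ('C(n - k - 1, k))%:R * ('C(2 * n - 2 * k, n))%:R :> rat.
Proof.
move=> A; pose l := [seq w <- preimages (iota 1 n) | des (stack_sort w) == k].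
(* A word and its image have the same letters, so each is a permutation of 1, ..., n exactly when
   the other is. *)
have EA : A = [set` l]%classic.
  apply/seteqP; split=> w /=.
    move=> [/andP[uw _] [[pw av] dw]].
    have us : uniq (stack_sort w) by rewrite (perm_uniq (perm_stack_sort uw)).
    have {}pw : perm_eq w (iota 1 n).
      by apply: perm_trans pw; rewrite perm_sym perm_stack_sort.
    rewrite mem_filter mem_preimages -size_descents dw eqxx pw.
    by apply/(avoid_layered us).
  rewrite mem_filter mem_preimages => /andP[/eqP dw /andP[pw lw]].
  have uw : uniq w by rewrite (perm_uniq pw) iota_uniq.
  have us : uniq (stack_sort w) by rewrite (perm_uniq (perm_stack_sort uw)).
  split; first by rewrite /is_perm_word uw (perm_mem pw) mem_iota.
  split; last by rewrite size_descents.
  split; first exact: perm_trans (perm_stack_sort uw) pw.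
  exact/(avoid_layered us).
have ul : uniq l by rewrite filter_uniq ?uniq_preimages.
split; first by rewrite EA; apply: finite_seq.
rewrite -(coef_preimages_weightE k hn) coef_preimages_weight -/l; congr (_%:R).
have -> : fset_set A = seq_fset tt l.
  apply/fsetP => w; rewrite in_fset_set ?EA ?seq_fsetE; last exact: finite_seq.
  by apply/idP/idP; rewrite inE.
by rewrite size_seq_fset undup_id.
Qed.
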